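(* Assume the following Lipschitz continuity conditions for the force matrix $\boldsymbol{F}$: there exist $K_1, K_2 > 0$ such that for any $(v,e,x), (v',e',x') \in \mathcal{V}\times\mathcal{E}\times\mathcal{V}$, $$\|F^{1}(v,e,x)-F^{1}(v',e',x')\|_2 \le K_1\, |||(v-v',e-e',x-x')|||,$$ $$\|F^{tv}(v,e,x)-F^{tv}(v',e',x')\|_2 \le K_2\, |||(v-v',e-e',x-x')|||.$$ Then there exists a generic constant $C>0$ such that for $t>0$ (with $t\le t_f$), $$|||(\varepsilon_v(t),\varepsilon_e(t),\varepsilon_x(t))||| \le C e^{Ct}\Big[\, |||(\zeta_v,\zeta_e,\zeta_x)||| + \max_{0\le s\le t} |||(\theta_v(s),\theta_e(s),\theta_x(s))||| + \int_0^t \Big( \|(I_{\mathcal V}-\mathcal{P}_{F^1})F^1(v(s),e(s),x(s))\|_2 + \|(I_{\mathcal E}-\mathcal{P}_{F^{tv}})F^{tv}(v(s),e(s),x(s))\|_2 \Big)\,ds \Big],$$ where $(v(s),e(s),x(s))$ is the full order model solution, $\varepsilon_v,\varepsilon_e,\varepsilon_x$ are the differences between the full order model solution and the lifted reduced order approximation, and $$\zeta_v = \Phi_v\big[\widehat v(0)-\widehat M_{\mathcal V}^{-1}\Phi_v^T M_{\mathcal V}(v(0)-v_{os})\big],\qquad \theta_v(t) = (I_{\mathcal V}-\Phi_v\widehat M_{\mathcal V}^{-1}\Phi_v^T M_{\mathcal V})(v(t)-v_{os}),$$ $$\zeta_e = \Phi_e\big[\widehat e(0)-\widehat M_{\mathcal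 E}^{-1}\Phi_e^T M_{\mathcal E}(e(0)-e_{os})\big],\qquad \theta_e(t) = (I_{\mathcal E}-\Phi_e\widehat M_{\mathcal E}^{-1}\Phi_e^T M_{\mathcal E})(e(t)-e_{os}),$$ $$\zeta_x = \Phi_x\big[\widehat x(0)-\Phi_x^T(x(0)-x_{os})\big],\qquad \theta_x(t) = (I_{\mathcal V}-\Phi_x\Phi_x^T)(x(t)-x_{os}).$$
   Context: Spaces and norms. $\mathcal V$ (kinematic) and $\mathcal E$ (thermodynamic) are finite element spaces of dimensions $N_{\mathcal V}$ and $N_{\mathcal E}$; their elements are identified with coefficient vectors in $\mathbb{R}^{N_{\mathcal V}}$ and $\mathbb{R}^{N_{\mathcal E}}$. $I_{\mathcal V}, I_{\mathcal E}$ are the identity matrices of sizes $N_{\mathcal V}, N_{\mathcal E}$. The mass matrices $M_{\mathcal V}\in\mathbb{R}^{N_{\mathcal V}\times N_{\mathcal V}}$ and $M_{\mathcal E}\in\mathbb{R}^{N_{\mathcal E}\times N_{\mathcal E}}$ are symmetric positive definite and constant in time. Put $\|v\|_{M_{\mathcal V}}^2 = v^T M_{\mathcal V} v$, $\|e\|_{M_{\mathcal E}}^2 = e^T M_{\mathcal E} e$, let $\|\cdot\|_2$ be the Euclidean norm, and on $\mathcal V\times\mathcal E\times\mathcal V$ define $$|||(v,e,x)|||^2 = \|v\|_{M_{\mathcal V}}^2 + \|e\|_{M_{\mathcal E}}^2 + \|x\|_2^2 .$$ Force functions. $\boldsymbol F=\boldsymbol F(v,e,x)\in\mathbb{R}^{N_{\mathcal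 V}\times N_{\mathcal E}}$ is the (nonlinear, matrix-valued) force matrix depending on the state $(v,e,x)$, and $F^1(v,e,x) = \boldsymbol F(v,e,x)\,\mathbf 1\in\mathbb{R}^{N_{\mathcal V}}$ (with $\mathbf 1\in\mathbb{R}^{N_{\mathcal E}}$ the vector of ones), $F^{tv}(v,e,x) = \boldsymbol F(v,e,x)^T v\in\mathbb{R}^{N_{\mathcal E}}$. The dependence on the problem parameter is fixed and suppressed. Full order model (FOM), on the time interval $[0,t_f]$, with solution $(v,e,x)$ and given initial values $(v(0),e(0),x(0))$: $$M_{\mathcal V}\frac{dv}{dt} = -F^1(v,e,x),\qquad M_{\mathcal E}\frac{de}{dt} = F^{tv}(v,e,x),\qquad \frac{dx}{dt}=v.$$ Reduced order model (ROM). $\Phi_v\in\mathbb{R}^{N_{\mathcal V}\times n_v}$, $\Phi_e\in\mathbb{R}^{N_{\mathcal E}\times n_e}$, $\Phi_x\in\mathbb{R}^{N_{\mathcal V}\times n_x}$ are basis matrices with orthonormal columns; $v_{os}\in\mathbb{R}^{N_{\mathcal V}}$, $e_{os}\in\mathbb{R}^{N_{\mathcal E}}$, $x_{os}\in\mathbb{R}^{N_{\mathcal V}}$ are prescribed offset vectors (constant in time). The reduced mass matrices are $\widehat M_{\mathcal V}=\Phi_v^T M_{\mathcal V}\Phi_v$, $\widehat M_{\mathcal E}=\Phi_e^T M_{\mathcal E}\Phi_e$. The oblique projection matrices are $$\mathcal P_{F^1}=\Phi_{F^1}(Z_{F^1}^T\Phi_{F^1})^{\dagger}Z_{F^1}^T\in\mathbb{R}^{N_{\mathcal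 V}\times N_{\mathcal V}},\qquad \mathcal P_{F^{tv}}=\Phi_{F^{tv}}(Z_{F^{tv}}^T\Phi_{F^{tv}})^{\dagger}Z_{F^{tv}}^T\in\mathbb{R}^{N_{\mathcal E}\times N_{\mathcal E}},$$ where $\Phi_{F^1}$, $\Phi_{F^{tv}}$ are the nonlinear-term basis matrices, $Z_{F^1}$, $Z_{F^{tv}}$ are sampling matrices (whose columns are selected columns of the identity matrix, at least as many as the columns of the corresponding basis matrix), $Z^T\Phi$ has full column rank in each case, and $A^\dagger=(A^TA)^{-1}A^T$. The continuous-in-time (hyper-reduced) ROM for $(\widehat v,\widehat e,\widehat x)$ on $[0,t_f]$, with prescribed initial values $(\widehat v(0),\widehat e(0),\widehat x(0))$, is $$\widehat M_{\mathcal V}\frac{d\widehat v}{dt} = -\Phi_v^T\mathcal P_{F^1}F^1(\tilde v,\tilde e,\tilde x),\qquad \widehat M_{\mathcal E}\frac{d\widehat e}{dt} = \Phi_e^T\mathcal P_{F^{tv}}F^{tv}(\tilde v,\tilde e,\tilde x),\qquad \frac{d\widehat x}{dt}=\Phi_x^T\tilde v,$$ where the lifted approximations are $\tilde v = v_{os}+\Phi_v\widehat v$, $\tilde e=e_{os}+\Phi_e\widehat e$, $\tilde x=x_{os}+\Phi_x\widehat x$. Errors: $\varepsilon_v=v-\tilde v$, $\varepsilon_e=e-\tilde e$, $\varepsilon_x=x-\tilde x$. *)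

(* Defs.v *)
From HB Require Import structures.
From mathcomp Require Import all_boot all_order all_algebra.
From mathcomp Require Import all_classical all_reals all_analysis.
Import Order.TTheory GRing.Theory Num.Theory.
Import numFieldNormedType.Exports.

Set Implicit Arguments.
Unset Strict Implicit.
Unset Printing Implicit Defensive.

Local Open Scope classical_set_scope.
Local Open Scope ring_scope.

(* The library norm `|u| on 'cV[R]_n is the max norm, hence these definitions. *)
Definition norm2 (R : realType) (n : nat) (u : 'cV[R]_n) : R :=
  Num.sqrt (\sum_i u i 0 ^+ 2).

Definition mass_norm (R : realType) (n : nat) (M : 'M[R]_n) (u : 'cV[R]_n) : R :=
  Num.sqrt ((u^T *m M *m u) 0 0).

Definition triple_norm (R : realType) (NV NE : nat) (MV : 'M[R]_NV)
    (ME : 'M[R]_NE) (v : 'cV[R]_NV) (e : 'cV[R]_NE) (x : 'cV[R]_NV) : R :=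
  Num.sqrt (mass_norm MV v ^+ 2 + mass_norm ME e ^+ 2 + norm2 x ^+ 2).

Definition sym_posdef (R : realType) (n : nat) (M : 'M[R]_n) : Prop :=
  M^T = M /\ forall u : 'cV[R]_n, u != 0 -> 0 < (u^T *m M *m u) 0 0.

Definition orthonormal_cols (R : realType) (N n : nat) (Phi : 'M[R]_(N, n)) :
  Prop := Phi^T *m Phi = 1%:M.

(* The columns of Z are columns of the identity matrix; repetitions are not
   excluded. *)
Definition sampling_matrix (R : realType) (N m : nat) (Z : 'M[R]_(N, m)) :
  Prop := exists idx : 'I_m -> 'I_N, Z = colsub idx 1%:M.

(* Moore-Penrose inverse of a matrix of full column rank. *)
Definition left_pinv (R : realType) (m n : nat) (A : 'M[R]_(m, n)) :
  'M[R]_(n, m) := invmx (A^T *m A) *m A^T.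

Definition oblique_proj (R : realType) (N r m : nat) (Phi : 'M[R]_(N, r))
  (Z : 'M[R]_(N, m)) : 'M[R]_N := Phi *m left_pinv (Z^T *m Phi) *m Z^T.

Definition state_fun (R : realType) (NV NE : nat) (T : Type) : Type :=
  'cV[R]_NV -> 'cV[R]_NE -> 'cV[R]_NV -> T.

Definition F1 (R : realType) (NV NE : nat)
    (F : state_fun R NV NE 'M[R]_(NV, NE)) : state_fun R NV NE 'cV[R]_NV :=
  fun v e x => F v e x *m const_mx 1.

Definition Ftv (R : realType) (NV NE : nat)
    (F : state_fun R NV NE 'M[R]_(NV, NE)) : state_fun R NV NE 'cV[R]_NE :=
  fun v e x => (F v e x)^T *m v.

(* Derivative at t relative to A: one-sided at the endpoints of an interval A.
   The target lives in R^n with its product topology. *)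
Definition has_deriv_within (R : realType) (n : nat) (A : set R)
    (f : R -> 'cV[R]_n) (t : R) (l : 'cV[R]_n) : Prop :=
  (s - t)^-1 *: (f s - f t) @[s --> within A t^'] --> l.

Definition FOM_solution (R : realType) (NV NE : nat)
    (MV : 'M[R]_NV) (ME : 'M[R]_NE) (F : state_fun R NV NE 'M[R]_(NV, NE))
    (tf : R) (v : R -> 'cV[R]_NV) (e : R -> 'cV[R]_NE) (x : R -> 'cV[R]_NV) :
    Prop :=
  forall t : R, t \in `[0, tf] -> exists dv de dx,
    [/\ has_deriv_within `[0, tf] v t dv,
        has_deriv_within `[0, tf] e t de &
        has_deriv_within `[0, tf] x t dx] /\
    [/\ MV *m dv = - F1 F (v t) (e t) (x t),
        ME *m de = Ftv F (v t) (e t) (x t) &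
        dx = v t].

Definition reduced_mass (R : realType) (N n : nat) (M : 'M[R]_N)
  (Phi : 'M[R]_(N, n)) : 'M[R]_n := Phi^T *m M *m Phi.

Definition affine_lift (R : realType) (N n : nat) (os : 'cV[R]_N)
  (Phi : 'M[R]_(N, n)) (u : 'cV[R]_n) : 'cV[R]_N := os + Phi *m u.

Definition ROM_solution (R : realType) (NV NE nv ne nx : nat)
    (MV : 'M[R]_NV) (ME : 'M[R]_NE) (F : state_fun R NV NE 'M[R]_(NV, NE))
    (Phiv : 'M[R]_(NV, nv)) (Phie : 'M[R]_(NE, ne)) (Phix : 'M[R]_(NV, nx))
    (PF1 : 'M[R]_NV) (PFtv : 'M[R]_NE)
    (vos : 'cV[R]_NV) (eos : 'cV[R]_NE) (xos : 'cV[R]_NV) (tf : R)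
    (vh : R -> 'cV[R]_nv) (eh : R -> 'cV[R]_ne) (xh : R -> 'cV[R]_nx) : Prop :=
  forall t : R, t \in `[0, tf] -> exists dv de dx,
    let vt := affine_lift vos Phiv (vh t) in
    let et := affine_lift eos Phie (eh t) in
    let xt := affine_lift xos Phix (xh t) in
    [/\ has_deriv_within `[0, tf] vh t dv,
        has_deriv_within `[0, tf] eh t de &
        has_deriv_within `[0, tf] xh t dx] /\
    [/\ reduced_mass MV Phiv *m dv = - (Phiv^T *m PF1 *m F1 F vt et xt),
        reduced_mass ME Phie *m de = Phie^T *m PFtv *m Ftv F vt et xt &
        dx = Phix^T *m vt].

(* invmx (reduced_mass M Phi) *m Phi^T *m M gives the coordinates of the
   M-orthogonal projection onto the column space of Phi. *)
Definition mass_zeta (R : realType) (N n : nat) (M : 'M[R]_N)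
    (Phi : 'M[R]_(N, n)) (os : 'cV[R]_N) (uh0 : 'cV[R]_n) (u0 : 'cV[R]_N) :
    'cV[R]_N :=
  Phi *m (uh0 - invmx (reduced_mass M Phi) *m Phi^T *m M *m (u0 - os)).

Definition mass_theta (R : realType) (N n : nat) (M : 'M[R]_N)
    (Phi : 'M[R]_(N, n)) (os u : 'cV[R]_N) : 'cV[R]_N :=
  (1%:M - Phi *m invmx (reduced_mass M Phi) *m Phi^T *m M) *m (u - os).

Definition eucl_zeta (R : realType) (N n : nat) (Phi : 'M[R]_(N, n))
    (os : 'cV[R]_N) (uh0 : 'cV[R]_n) (u0 : 'cV[R]_N) : 'cV[R]_N :=
  Phi *m (uh0 - Phi^T *m (u0 - os)).

Definition eucl_theta (R : realType) (N n : nat) (Phi : 'M[R]_(N, n))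
    (os u : 'cV[R]_N) : 'cV[R]_N :=
  (1%:M - Phi *m Phi^T) *m (u - os).

(* A supremum, attained when f is continuous on [0, t]. *)
Definition max_upto (R : realType) (t : R) (f : R -> R) : R :=
  sup [set f s | s in `[0, t]].

(* Main.v *)
(* For each variable let [theta] be the part of the (shifted) FOM solution lost
   by projecting onto the reduced basis and let [rho] be the ROM solution minus
   that projection, so that the error is [theta - rho] and [rho] starts at
   [zeta]. Subtracting the projected FOM from the ROM and writing
   [F - P F~ = (1 - P) F + P (F - F~)], the Lipschitz bounds give
   [|rho'| <= c g + k (|theta| + |rho|)], where [g] is the integrand of the
   hyper-reduction term; Gronwall's inequality concludes. *)
Require Import Defs.
From HB Require Import structures.
From mathcomp Require Import all_boot all_order all_algebra.
From mathcomp Require Import all_classical all_reals all_analysis.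
From mathcomp Require Import ring lra.
Import Order.TTheory GRing.Theory Num.Theory.
Import numFieldNormedType.Exports.

Set Implicit Arguments.
Unset Strict Implicit.
Unset Printing Implicit Defensive.

Local Open Scope classical_set_scope.
Local Open Scope ring_scope.

(** * Inner products and norms given by mass matrices *)

Section MassNorm.
Variable R : realType.

(** For [sym_posdef M] this is the inner product whose norm is [mass_norm M]. *)
Definition mdot n (M : 'M[R]_n) (u w : 'cV[R]_n) : R := (u^T *m M *m w) 0 0.

Lemma mdotE n (M : 'M[R]_n) u w :
  mdot M u w = \sum_i \sum_j u i 0 * M i j * w j 0.
Proof.
rewrite /mdot mxE exchange_big /=; apply: eq_bigr => j _.
rewrite mxE mulr_suml; apply: eq_bigr => i _; by rewrite mxE.
Qed.

Lemma mdotDl n (M : 'M[R]_n) u u' w :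
  mdot M (u + u') w = mdot M u w + mdot M u' w.
Proof. by rewrite /mdot linearD /= !mulmxDl mxE. Qed.

Lemma mdotDr n (M : 'M[R]_n) u w w' :
  mdot M u (w + w') = mdot M u w + mdot M u w'.
Proof. by rewrite /mdot mulmxDr mxE. Qed.

Lemma mdotZl n (M : 'M[R]_n) a u w : mdot M (a *: u) w = a * mdot M u w.
Proof. by rewrite /mdot linearZ /= -!scalemxAl mxE. Qed.

Lemma mdotZr n (M : 'M[R]_n) a u w : mdot M u (a *: w) = a * mdot M u w.
Proof. by rewrite /mdot -!scalemxAr mxE. Qed.

Lemma mdotC n (M : 'M[R]_n) u w : M^T = M -> mdot M u w = mdot M w u.
Proof.
move=> symM; rewrite /mdot.
have -> : u^T *m M *m w = (w^T *m M *m u)^T.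
  by rewrite !trmx_mul trmxK symM mulmxA.
by rewrite mxE.
Qed.

Lemma mass_normE n (M : 'M[R]_n) u : mass_norm M u = Num.sqrt (mdot M u u).
Proof. by []. Qed.

Lemma mass_norm_ge0 n (M : 'M[R]_n) u : 0 <= mass_norm M u.
Proof. exact: sqrtr_ge0. Qed.

Lemma norm2_ge0 n (u : 'cV[R]_n) : 0 <= norm2 u.
Proof. exact: sqrtr_ge0. Qed.

Lemma mass_normN n (M : 'M[R]_n) u : mass_norm M (- u) = mass_norm M u.
Proof. by rewrite !mass_normE -scaleN1r mdotZl mdotZr mulrA mulrNN !mul1r. Qed.

Section PosDef.
Variables (n : nat) (M : 'M[R]_n) (Mspd : sym_posdef M).
Implicit Types u w : 'cV[R]_n.

Lemma mdot_ge0 u : 0 <= mdot M u u.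
Proof.
have [->|u0] := eqVneq u 0; first by rewrite /mdot mulmx0 mxE.
by apply: ltW; apply: Mspd.2.
Qed.

Lemma sqr_mass_norm u : mass_norm M u ^+ 2 = mdot M u u.
Proof. by rewrite mass_normE sqr_sqrtr // mdot_ge0. Qed.

(** Cauchy-Schwarz: for [w != 0], put [a = <u, u>], [b = <u, w>] and [c = <w, w> > 0]. Nonnegativity
    of the form at [c u - b w] then reads [c (a c - b^2) >= 0]. *)
Lemma mdot_sqr_le u w : mdot M u w ^+ 2 <= mdot M u u * mdot M w w.
Proof.
have [->|w0] := eqVneq w 0.
  by rewrite /mdot !mulmx0 !mxE expr0n mulr0.
have ww : 0 < mdot M w w by apply: Mspd.2.
have := mdot_ge0 (mdot M w w *: u + (- mdot M u w) *: w).
rewrite !mdotDl !mdotDr !mdotZl !mdotZr (mdotC w u Mspd.1).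
set a := mdot M u u; set b := mdot M u w; set c := mdot M w w in ww *.
have -> : c * (c * a) + c * (- b * b) + (- b * (c * b) + - b * (- b * c)) =
  c * (a * c - b ^+ 2) by ring.
by rewrite pmulr_rge0 // subr_ge0.
Qed.

Lemma mdot_le_mass_norm u w : mdot M u w <= mass_norm M u * mass_norm M w.
Proof.
apply: le_trans (ler_norm _) _.
rewrite -(ler_pXn2r (n := 2)) ?nnegrE ?mulr_ge0 ?mass_norm_ge0 ?normr_ge0 //.
by rewrite exprMn !sqr_mass_norm real_normK ?num_real // mdot_sqr_le.
Qed.

Lemma mass_normD u w : mass_norm M (u + w) <= mass_norm M u + mass_norm M w.
Proof.
rewrite -(ler_pXn2r (n := 2)) ?nnegrE ?addr_ge0 ?mass_norm_ge0 //.
rewrite sqrrD !sqr_mass_norm mdotDl !mdotDr (mdotC w u Mspd.1).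
have := mdot_le_mass_norm u w; lra.
Qed.

(** A row [r] of the left kernel satisfies [r M r^T = 0], so positivity forces [r = 0]. *)
Lemma sym_posdef_unit : M \in unitmx.
Proof.
rewrite -row_free_unit -kermx_eq0; apply/eqP/row_matrixP => i; rewrite row0.
set r := row i _.
have rM : r *m M = 0 by rewrite /r -row_mul mulmx_ker row0.
apply/eqP/negPn/negP => r0.
have /Mspd.2 : r^T != 0 by rewrite trmx_eq0.
by rewrite trmxK rM mul0mx mxE ltxx.
Qed.

(** Orthonormal columns make [Phi] injective, so positivity passes from [M] to [Phi^T M Phi]. *)
Lemma reduced_mass_spd m (Phi : 'M[R]_(n, m)) :
  orthonormal_cols Phi -> sym_posdef (reduced_mass M Phi).
Proof.
move=> Phi_on; split; first by rewrite !trmx_mul trmxK Mspd.1 mulmxA.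
move=> u u0; have := Mspd.2 (Phi *m u); rewrite trmx_mul !mulmxA; apply.
apply: contraNneq u0 => Phiu.
by rewrite -[u]mul1mx -[1%:M]Phi_on -mulmxA Phiu mulmx0.
Qed.

End PosDef.

Lemma norm2E n (u : 'cV[R]_n) : norm2 u = mass_norm 1%:M u.
Proof.
rewrite /norm2 /mass_norm mulmx1 mxE; congr Num.sqrt.
by apply: eq_bigr => i _; rewrite mxE expr2.
Qed.

Lemma norm2N n (u : 'cV[R]_n) : norm2 (- u) = norm2 u.
Proof. by rewrite !norm2E mass_normN. Qed.

Lemma sym_posdef1 n : sym_posdef (1%:M : 'M[R]_n).
Proof.
split=> [|u u0]; first exact: trmx1.
rewrite mulmx1 mxE lt_neqAle; apply/andP; split; last first.
  by apply: sumr_ge0 => i _; rewrite mxE -expr2 sqr_ge0.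
apply: contraNneq u0 => /esym/eqP.
rewrite psumr_eq0 => [/allP u0|i _]; last by rewrite mxE -expr2 sqr_ge0.
apply/eqP/matrixP => i j; rewrite ord1 [RHS]mxE; apply/eqP.
by have := u0 i (mem_index_enum _); rewrite mxE mulf_eq0 orbb.
Qed.

(** * Block-diagonal mass matrices and the triple norm *)

Lemma mdot_block n m (A : 'M[R]_n) (B : 'M[R]_m) u u' w w' :
  mdot (block_mx A 0 0 B) (col_mx u w) (col_mx u' w') =
  mdot A u u' + mdot B w w'.
Proof.
by rewrite /mdot tr_col_mx mul_row_block !mulmx0 addr0 add0r mul_row_col mxE.
Qed.

Lemma sym_posdef_block n m (A : 'M[R]_n) (B : 'M[R]_m) :
  sym_posdef A -> sym_posdef B -> sym_posdef (block_mx A 0 0 B).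
Proof.
move=> Aspd Bspd; split.
  by rewrite tr_block_mx !trmx0 Aspd.1 Bspd.1.
move=> u; rewrite -[u]vsubmxK => u0; rewrite -/(mdot _ _ _) mdot_block.
have [u1|u1] := eqVneq (usubmx u) 0.
  apply: ltr_wpDl; first exact: mdot_ge0.
  by apply: Bspd.2; apply: contraNneq u0 => u2; rewrite u1 u2 col_mx0.
by apply: ltr_wpDr; [exact: mdot_ge0 | exact: Aspd.2].
Qed.

Lemma mass_norm_block_le n m (A : 'M[R]_n) (B : 'M[R]_m) u w :
  sym_posdef A -> sym_posdef B ->
  mass_norm (block_mx A 0 0 B) (col_mx u w) <= mass_norm A u + mass_norm B w.
Proof.
move=> Aspd Bspd.
rewrite -(ler_pXn2r (n := 2)) ?nnegrE ?addr_ge0 ?mass_norm_ge0 //.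
rewrite sqr_mass_norm; last exact: sym_posdef_block.
rewrite mdot_block sqrrD !sqr_mass_norm //.
have := mulr_ge0 (mass_norm_ge0 A u) (mass_norm_ge0 B w); lra.
Qed.

(** Its mass norm on the stacked state is the triple norm, so Cauchy-Schwarz and the triangle
    inequality for [mass_norm] apply to the whole state at once. *)
Definition state_mass NV NE (MV : 'M[R]_NV) (ME : 'M[R]_NE) :=
  block_mx (block_mx MV 0 0 ME) 0 0 (1%:M : 'M[R]_NV).

Lemma state_mass_spd NV NE (MV : 'M[R]_NV) (ME : 'M[R]_NE) :
  sym_posdef MV -> sym_posdef ME -> sym_posdef (state_mass MV ME).
Proof.
move=> MV_spd ME_spd; apply: sym_posdef_block (sym_posdef1 _).
exact: sym_posdef_block.
Qed.

Lemma triple_normE NV NE (MV : 'M[R]_NV) (ME : 'M[R]_NE) v e x :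
  sym_posdef MV -> sym_posdef ME ->
  triple_norm MV ME v e x =
  mass_norm (state_mass MV ME) (col_mx (col_mx v e) x).
Proof.
move=> MV_spd ME_spd; rewrite /triple_norm norm2E.
rewrite !sqr_mass_norm //; last exact: sym_posdef1.
by rewrite mass_normE !mdot_block.
Qed.

(** * Comparison of mass norms with the Euclidean norm *)

Lemma coord_le_norm2 n (u : 'cV[R]_n) i : `|u i 0| <= norm2 u.
Proof.
rewrite -sqrtr_sqr; apply: ler_wsqrtr; rewrite (bigD1 i) //= lerDl.
by apply: sumr_ge0 => j _; rewrite sqr_ge0.
Qed.

Lemma mdot_le_norm2 n (M : 'M[R]_n) u :
  mdot M u u <= (\sum_i \sum_j `|M i j|) * norm2 u ^+ 2.
Proof.
rewrite mdotE mulr_suml; apply: ler_sum => i _.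
rewrite mulr_suml; apply: ler_sum => j _.
apply: le_trans (ler_norm _) _; rewrite !normrM (mulrC `|u i 0|) -mulrA expr2.
by rewrite ler_wpM2l // ler_pM // coord_le_norm2.
Qed.

(** The left side is [mass_norm] of the matrix [K^T M K] at [y], and the sum of the absolute values
    of its entries bounds that quadratic form on the unit sphere. *)
Lemma mass_norm_mulmx_le n m (M : 'M[R]_n) (K : 'M[R]_(n, m)) :
  exists c, 0 <= c /\ forall y, mass_norm M (K *m y) <= c * norm2 y.
Proof.
exists (Num.sqrt (\sum_i \sum_j `|(K^T *m M *m K) i j|)).
split=> [|y]; first exact: sqrtr_ge0.
have -> : mass_norm M (K *m y) = mass_norm (K^T *m M *m K) y.
  by rewrite /mass_norm trmx_mul !mulmxA.
rewrite mass_normE.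
have /ler_wsqrtr/le_trans := mdot_le_norm2 (K^T *m M *m K) y; apply.
rewrite sqrtrM ?sqrtr_sqr ?ger0_norm ?norm2_ge0 //.
by apply: sumr_ge0 => i _; apply: sumr_ge0.
Qed.

(* |u|_2^2 = <u, M^-1 u>_M, so Cauchy-Schwarz for the M-product gives the lower
   bound of the norm equivalence without any compactness argument. *)
Lemma norm2_le_mass_norm n (M : 'M[R]_n) : sym_posdef M ->
  exists c, 0 <= c /\ forall u, norm2 u <= c * mass_norm M u.
Proof.
move=> Mspd; have [c [c0 cP]] := mass_norm_mulmx_le M (invmx M).
exists c; split=> // u.
have : norm2 u ^+ 2 <= mass_norm M u * (c * norm2 u).
  apply: le_trans (ler_wpM2l (mass_norm_ge0 _ _) (cP u)).
  apply: le_trans (mdot_le_mass_norm Mspd _ _).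
  rewrite norm2E sqr_mass_norm; last exact: sym_posdef1.
  by rewrite /mdot mulmxA mulmxK ?mulmx1 ?sym_posdef_unit.
have [->|] := eqVneq (norm2 u) 0; first by rewrite mulr_ge0 ?mass_norm_ge0.
rewrite neq_lt ltNge norm2_ge0 /= => u0.
by rewrite mulrA expr2 ler_pM2r // mulrC.
Qed.

End MassNorm.

(** * Continuity and derivatives of vector-valued functions *)

Section Calculus.
Variable R : realType.

Lemma within_continuous_sum (I : Type) (r : seq I) (A : set R)
    (f : I -> R -> R) :
  (forall i, {within A, continuous (f i)}) ->
  {within A, continuous (fun s => \sum_(i <- r) f i s)}.
Proof.
move=> cf; elim: r => [|i r IH].
  rewrite (_ : (fun s => _) = fun=> 0); last first.
    by apply/funext => s; rewrite big_nil.
  by move=> s; exact: cvg_cst.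
rewrite (_ : (fun s => _) = f i + (fun s => \sum_(j <- r) f j s)).
  by apply: within_continuousD; [exact: cf | exact: IH].
by apply/funext => s; rewrite big_cons.
Qed.

Lemma within_continuousM (A : set R) (f g : R -> R) :
  {within A, continuous f} -> {within A, continuous g} ->
  {within A, continuous (fun s => f s * g s)}.
Proof. by move=> cf cg s; apply: cvgM; [exact: cf | exact: cg]. Qed.

Lemma within_continuous_cst (A : set R) (a : R) :
  {within A, continuous (fun=> a)}.
Proof. by move=> s; exact: cvg_cst. Qed.

Lemma within_continuous_sqrt (A : set R) (f : R -> R) :
  {within A, continuous f} -> {within A, continuous (fun s => Num.sqrt (f s))}.
Proof.
move=> cf; apply: (@within_continuous_comp _ _ _ A f Num.sqrt) => // x _.
exact: sqrt_continuous.
Qed.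

Lemma is_derive_big (I : Type) (r : seq I) (f : I -> R -> R) (df : I -> R)
    (s : R) :
  (forall i, is_derive s 1 (f i) (df i)) ->
  is_derive s 1 (fun x => \sum_(i <- r) f i x) (\sum_(i <- r) df i).
Proof.
move=> fdf; elim: r => [|i r IH].
  under eq_fun do rewrite big_nil.
  by rewrite big_nil; exact: is_derive_cst.
under eq_fun do rewrite big_cons.
by rewrite big_cons; apply: is_deriveD.
Qed.

(** Taken coordinatewise, as is [is_vderive], so that the calculus of real functions applies
    directly. *)
Definition vcontinuous (A : set R) n (u : R -> 'cV[R]_n) :=
  forall i, {within A, continuous (fun s => u s i 0)}.

Definition is_vderive n (u : R -> 'cV[R]_n) (s : R) (du : 'cV[R]_n) :=
  forall i, is_derive s 1 (fun s => u s i 0) (du i 0).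

Lemma vcontinuous_cst A n (a : 'cV[R]_n) : vcontinuous A (fun=> a).
Proof. by move=> i; exact: within_continuous_cst. Qed.

Lemma vcontinuousB A n (u w : R -> 'cV[R]_n) :
  vcontinuous A u -> vcontinuous A w -> vcontinuous A (fun s => u s - w s).
Proof.
move=> cu cw i.
under [X in continuous X]eq_fun do rewrite !mxE.
exact: within_continuousB.
Qed.

Lemma vcontinuous_mulmx A n m (K : 'M[R]_(m, n)) (u : R -> 'cV[R]_n) :
  vcontinuous A u -> vcontinuous A (fun s => K *m u s).
Proof.
move=> cu i; under [X in continuous X]eq_fun do rewrite mxE.
apply: within_continuous_sum => j.
by apply: within_continuousM; [exact: within_continuous_cst | exact: cu].
Qed.

Lemma vcontinuous_col A n m (u : R -> 'cV[R]_n) (w : R -> 'cV[R]_m) :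
  vcontinuous A u -> vcontinuous A w ->
  vcontinuous A (fun s => col_mx (u s) (w s)).
Proof.
move=> cu cw i; under [X in continuous X]eq_fun do rewrite mxE.
by case: (fintype.split i) => j; [exact: cu | exact: cw].
Qed.

Lemma vcontinuousW (A B : set R) n (u : R -> 'cV[R]_n) :
  A `<=` B -> vcontinuous B u -> vcontinuous A u.
Proof. by move=> AB cu i; apply: continuous_subspaceW AB (cu i). Qed.

Lemma is_vderive_cst n (a : 'cV[R]_n) s : is_vderive (fun=> a) s 0.
Proof. by move=> i; rewrite mxE; exact: is_derive_cst. Qed.

Lemma is_vderiveB n (u w : R -> 'cV[R]_n) s du dw :
  is_vderive u s du -> is_vderive w s dw ->
  is_vderive (fun s => u s - w s) s (du - dw).
Proof.
move=> hu hw i; rewrite !mxE.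
under [X in is_derive _ _ X _]eq_fun do rewrite !mxE.
exact: is_deriveB.
Qed.

Lemma is_vderive_mulmx n m (K : 'M[R]_(m, n)) (u : R -> 'cV[R]_n) s du :
  is_vderive u s du -> is_vderive (fun s => K *m u s) s (K *m du).
Proof.
move=> hu i; rewrite mxE.
under [X in is_derive _ _ X _]eq_fun do rewrite mxE.
by apply: is_derive_big => j; apply: is_deriveZ.
Qed.

Lemma is_vderive_col n m (u : R -> 'cV[R]_n) (w : R -> 'cV[R]_m) s du dw :
  is_vderive u s du -> is_vderive w s dw ->
  is_vderive (fun s => col_mx (u s) (w s)) s (col_mx du dw).
Proof.
move=> hu hw i; rewrite mxE.
under [X in is_derive _ _ X _]eq_fun do rewrite mxE.
by case: (fintype.split i) => j; [exact: hu | exact: hw].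
Qed.

Lemma within_continuous_mdot A n (M : 'M[R]_n) u :
  vcontinuous A u -> {within A, continuous (fun s => mdot M (u s) (u s))}.
Proof.
move=> cu; under [X in continuous X]eq_fun do rewrite mdotE.
apply: within_continuous_sum => i; apply: within_continuous_sum => j.
apply: within_continuousM (cu j).
by apply: within_continuousM (cu i) _; exact: within_continuous_cst.
Qed.

Lemma within_continuous_mass_norm A n (M : 'M[R]_n) u :
  vcontinuous A u -> {within A, continuous (fun s => mass_norm M (u s))}.
Proof.
by move=> cu; apply: within_continuous_sqrt; exact: within_continuous_mdot.
Qed.

(** The product rule gives [<u, u'> + <u', u>]; symmetry of [M] merges the two terms. *)
Lemma is_derive_mdot n (M : 'M[R]_n) u s du : M^T = M ->
  is_vderive u s du ->
  is_derive s 1 (fun s => mdot M (u s) (u s)) (2 * mdot M (u s) du).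
Proof.
move=> symM hu.
have -> : 2 * mdot M (u s) du = mdot M (u s) du + mdot M du (u s).
  by rewrite (mdotC du _ symM); ring.
rewrite !mdotE -big_split /=.
under [X in is_derive _ _ X _]eq_fun do rewrite mdotE.
apply: is_derive_big => i; rewrite -big_split /=; apply: is_derive_big => j.
have hi := hu i; have hj := hu j.
have := is_deriveM (is_deriveM hi (is_derive_cst (M i j) s 1)) hj.
move=> /is_derive_eq; apply; rewrite /= /GRing.scale /= mulr0 add0r.
rewrite -[((fun s0 => u s0 i 0) * cst (M i j)) s]/(u s i 0 * M i j).
by ring.
Qed.

(** * Derivatives relative to a set *)

Lemma deriv_within_coord n (A : set R) (f : R -> 'cV[R]_n) t l i :
  has_deriv_within A f t l ->
  (s - t)^-1 * (f s i 0 - f t i 0) @[s --> within A t^'] --> l i 0.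
Proof.
move=> fl.
rewrite (_ : (fun s => _) =
  (fun M : 'cV[R]_n => M i 0) \o (fun s => (s - t)^-1 *: (f s - f t))).
  by apply: continuous_cvg => //; exact: coord_continuous.
by apply/funext => s; rewrite /= !mxE.
Qed.

Lemma deriv_within_dist n (A : set R) (f : R -> 'cV[R]_n) t l i e :
  has_deriv_within A f t l -> 0 < e ->
  exists2 d, 0 < d & forall s, `|t - s| < d -> s != t -> A s ->
    `|l i 0 - (s - t)^-1 * (f s i 0 - f t i 0)| < e.
Proof.
move=> /(@deriv_within_coord _ _ _ _ _ i)/cvgrPdist_lt fl /fl.
rewrite near_withinE /dnbhs near_withinE => /nbhs_ballP[d /= d0 dP].
by exists d => // s ts st As; apply: dP.
Qed.

(** Near [t] each difference quotient is within 1 of its limit, so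
    [|f s - f t| <= |s - t| (|l| + 1)] in each coordinate. This covers the endpoints of an interval,
    where the derivative is one-sided. *)
Lemma deriv_within_vcontinuous n (A : set R) (f : R -> 'cV[R]_n) :
  (forall t, A t -> exists l, has_deriv_within A f t l) -> vcontinuous A f.
Proof.
move=> df i; apply/subspace_continuousP => t At.
have [l fl] := df t At.
have [d d0 dP] := deriv_within_dist i fl ltr01.
apply/cvgrPdist_lt => e e0; rewrite near_withinE.
apply/nbhs_ballP.
have c0 : 0 < `|l i 0| + 1 by rewrite ltr_wpDl.
exists (Num.min d (e / (`|l i 0| + 1))) => /=.
  by rewrite lt_min d0 divr_gt0.
move=> s; rewrite /ball /= lt_min => /andP[tsd tse] As.
have [->|st] := eqVneq s t; first by rewrite subrr normr0.
have st0 : s - t != 0 by rewrite subr_eq0.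
have := dP s tsd st As; set q := _ * _ => ql.
have -> : f t i 0 - f s i 0 = (t - s) * q.
  by rewrite /q -(opprB s t) mulNr mulrA divff // mul1r opprB.
rewrite normrM; apply: le_lt_trans (_ : `|t - s| * (`|l i 0| + 1) < _).
  rewrite ler_wpM2l // -lerBlDl (le_trans _ (ltW ql)) //.
  by rewrite distrC lerB_dist.
by rewrite -ltr_pdivlMr.
Qed.

(** At an interior point, increments smaller than the distance to both endpoints stay inside the
    interval, so the relative derivative is an ordinary one. *)
Lemma deriv_within_is_vderive n (a b : R) (f : R -> 'cV[R]_n) t l :
  t \in `]a, b[ -> has_deriv_within `[a, b] f t l -> is_vderive f t l.
Proof.
move=> tab fl i.
suff H : h^-1 *: (f (h *: 1 + t) i 0 - f t i 0) @[h --> 0^'] --> l i 0.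
  apply: DeriveDef; first by apply/cvg_ex; exists (l i 0).
  exact/cvg_lim.
apply/cvgrPdist_lt => e e0.
have [d d0 dP] := deriv_within_dist i fl e0.
move: tab; rewrite in_itv /= => /andP[at_ tb].
apply/nbhs_ballP; exists (Num.min d (Num.min (t - a) (b - t))) => /=.
  by rewrite !lt_min d0 !subr_gt0 at_.
move=> h; rewrite /ball /= sub0r normrN !lt_min => /and3P[hd ha hb] h0.
have := dP (h + t); rewrite addrK opprD addrCA subrr addr0 normrN => /(_ hd).
rewrite [h *: 1]mulr1; apply.
  by rewrite -subr_eq0 addrK.
rewrite /= in_itv /=; move: ha hb; rewrite !ltr_norml; lra.
Qed.

End Calculus.

(** * Gronwall's inequality for square roots and mass norms *)

Section Gronwall.
Variable R : realType.
Local Notation mu := (@lebesgue_measure R).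

Lemma continuous_itv_integrable (a b : R) (f : R -> R) :
  {within `[a, b], continuous f} -> mu.-integrable `[a, b] (EFin \o f).
Proof. exact: (continuous_compact_integrable (@segment_compact _ a b)). Qed.

Lemma is_derive_integral (t s : R) (g : R -> R) :
  {within `[0, t], continuous g} -> s \in `]0, t[ ->
  is_derive s 1 (fun y => \int[mu]_(x in `[0, y]) g x) (g s).
Proof.
move=> cg; rewrite in_itv /= => /andP[s0 st].
have t0 : 0 < t by exact: lt_trans st.
have cgs : {for s, continuous g}.
  by apply: within_continuous_continuous t0 cg _; rewrite in_itv /= s0.
have [dF F'] := continuous_FTC1_closed st (continuous_itv_integrable cg) s0 cgs.
by apply: DeriveDef => //; rewrite -derive1E.
Qed.

(* The square root is regularised by [d], as it is not differentiable at 0; then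
   [exp (-k s) * sqrt (E s + d) - \int_0^s g] is nonincreasing. *)
Lemma gronwall_regularised (k t d : R) (E g : R -> R) :
  0 <= k -> 0 < t -> 0 < d ->
  {within `[0, t], continuous E} ->
  (forall s, s \in `[0, t] -> 0 <= E s) ->
  {within `[0, t], continuous g} ->
  (forall s, s \in `[0, t] -> 0 <= g s) ->
  (forall s, s \in `]0, t[ -> exists dE, is_derive s 1 E dE /\
     dE <= 2 * (Num.sqrt (E s) * (g s + k * Num.sqrt (E s)))) ->
  Num.sqrt (E t + d) <=
    expR (k * t) * (Num.sqrt (E 0 + d) + \int[mu]_(s in `[0, t]) g s).
Proof.
move=> k0 t0 d0 cE E0 cg g0 dE.
pose z s := expR (- k * s) * Num.sqrt (E s + d) - \int[mu]_(x in `[0, s]) g x.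
have zd s : s \in `]0, t[ -> exists2 dz, is_derive s 1 z dz & dz <= 0.
  move=> sI; have [e [hE eE]] := dE s sI.
  have sI' : s \in `[0, t] by apply: subset_itv_oo_cc.
  have y0 : 0 < E s + d by rewrite ltr_wpDl // E0.
  have hF := is_derive_integral cg sI.
  have hy : is_derive s 1 (fun x => Num.sqrt (E x + d))
      ((2 * Num.sqrt (E s + d))^-1 * e).
    have h1 : is_derive s 1 (fun x => E x + d) e.
      by have := is_deriveD hE (is_derive_cst d s 1); rewrite addr0.
    exact: (@is_derive1_comp _ _ (fun x => E x + d) s _ _
      (is_derive1_sqrt y0) h1).
  have hx : is_derive s 1 (fun x => expR (- k * x)) (- k * expR (- k * s)).
    have h1 : is_derive s 1 (fun x => - k * x) (- k).
      have := is_deriveZ (- k) (is_derive_id s 1).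
      by rewrite /GRing.scale /= mulr1.
    rewrite mulrC; exact: (@is_derive1_comp _ _ (fun x => - k * x) s _ _
      (is_derive_expR _) h1).
  exists (- k * expR (- k * s) * Num.sqrt (E s + d)
    + expR (- k * s) * ((2 * Num.sqrt (E s + d))^-1 * e) - g s).
    apply: is_deriveB.
    have := is_deriveM hx hy => /is_derive_eq; apply.
    by rewrite /GRing.scale /= addrC mulrC [X in _ + X]mulrC; ring.
  set q := expR _; set y := Num.sqrt (E s + d).
  have y_gt0 : 0 < y by rewrite sqrtr_gt0.
  have q_le1 : q <= 1.
    rewrite -expR0 ler_expR mulNr oppr_le0 mulr_ge0 //.
    by move: sI'; rewrite in_itv /= => /andP[].
  have ry : Num.sqrt (E s) <= y by rewrite ler_wsqrtr // lerDl ltW.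
  (* Replacing [sqrt (E s)] by the larger [y] in the bound on [e] produces a factor [2 * y], which
     cancels. *)
  have : (2 * y)^-1 * e <= g s + k * y.
    rewrite ler_pdivrMl ?mulr_gt0 //; apply: le_trans eE _; rewrite -mulrA.
    rewrite ler_wpM2l // ler_pM ?sqrtr_ge0 //; last by rewrite lerD2l ler_wpM2l.
    by rewrite addr_ge0 ?g0 ?mulr_ge0 ?sqrtr_ge0.
  have q_ge0 : 0 <= q by exact: expR_ge0.
  move=> /(ler_wpM2l q_ge0).
  have := ler_wpM2r (g0 _ sI') q_le1; rewrite mul1r mulrDr => qg h.
  (* The exponential weight cancels the growth term [k * y]. Two nonpositive terms remain, the
     second one because [q <= 1]. *)
  have -> : - k * q * y + q * ((2 * y)^-1 * e) - g s =
    (q * ((2 * y)^-1 * e) - (q * g s + q * (k * y))) + (q * g s - g s) by ring.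
  by rewrite -(addr0 0) lerD // subr_le0.
have cz : {within `[0, t], continuous z}.
  apply: within_continuousB.
    apply: within_continuousM.
      apply: continuous_subspaceT => x.
      apply: continuous_comp; last exact: continuous_expR.
      by apply: cvgM; [exact: cvg_cst | exact: cvg_id].
    apply: within_continuous_sqrt; apply: within_continuousD cE _.
    exact: within_continuous_cst.
  apply: parameterized_integral_continuous (ltW t0) _.
  exact: continuous_itv_integrable.
have : z t <= z 0.
  apply: (@ler0_derive1_le_cc _ z 0 t) => //.
  - by move=> s /zd[dz []].
  - by move=> s /zd[dz hz]; rewrite derive1E derive_val.
  - by rewrite in_itv /= lexx ltW.
  - by rewrite in_itv /= lexx ltW.
  - exact: ltW.
(* At 0 the integral runs over a single point and vanishes; multiplying [z t <= z 0] by [exp (k t)]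
   gives the claim. *)
rewrite /z mulr0 expR0 mul1r set_itv1 Rintegral_set1 subr0 lerBlDr.
rewrite mulNr expRN ler_pdivrMl ?expR_gt0 //.
Qed.

(** The regularisation parameter of [gronwall_regularised] is sent to 0. *)
Lemma gronwall_sqrt (k t : R) (E g : R -> R) :
  0 <= k -> 0 < t ->
  {within `[0, t], continuous E} ->
  (forall s, s \in `[0, t] -> 0 <= E s) ->
  {within `[0, t], continuous g} ->
  (forall s, s \in `[0, t] -> 0 <= g s) ->
  (forall s, s \in `]0, t[ -> exists dE, is_derive s 1 E dE /\
     dE <= 2 * (Num.sqrt (E s) * (g s + k * Num.sqrt (E s)))) ->
  Num.sqrt (E t) <=
    expR (k * t) * (Num.sqrt (E 0) + \int[mu]_(s in `[0, t]) g s).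
Proof.
move=> k0 t0 cE E0 cg g0 dE; set I := \int[mu]_(_ in _) _.
apply/ler_addgt0Pr => e e0.
have E00 : 0 <= E 0 by apply: E0; rewrite in_itv /= lexx ltW.
(* With [d = c^2] and [sqrt (E 0 + c^2) <= sqrt (E 0) + c], this choice makes the excess
   [c * exp (k t)] equal to [e]. *)
pose c := e / expR (k * t).
have c0 : 0 < c by rewrite divr_gt0 ?expR_gt0.
have d0 : 0 < c ^+ 2 by rewrite exprn_gt0.
have := gronwall_regularised k0 t0 d0 cE E0 cg g0 dE.
rewrite -/I => Ht; apply: le_trans (le_trans Ht _).
  by rewrite ler_wsqrtr // lerDl ltW.
have H0 : Num.sqrt (E 0 + c ^+ 2) <= Num.sqrt (E 0) + c.
  rewrite -(ler_pXn2r (n := 2)) ?nnegrE ?addr_ge0 ?sqrtr_ge0 ?(ltW c0) //.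
  rewrite sqr_sqrtr ?addr_ge0 ?(ltW d0) // sqrrD sqr_sqrtr //.
  by rewrite -addrA lerD2l lerDr mulrn_wge0 // mulr_ge0 ?sqrtr_ge0 ?(ltW c0).
apply: (@le_trans _ _ (expR (k * t) * (Num.sqrt (E 0) + c + I))).
  by rewrite ler_wpM2l ?expR_ge0 // lerD2r.
have -> : expR (k * t) * (Num.sqrt (E 0) + c + I) =
  expR (k * t) * (Num.sqrt (E 0) + I) + c * expR (k * t) by ring.
by rewrite /c divfK // gt_eqF ?expR_gt0.
Qed.

(** The squared norm has derivative [2 <u, u'>], and Cauchy-Schwarz brings it to the form that
    [gronwall_sqrt] expects. *)
Lemma gronwall_mass_norm n (M : 'M[R]_n) (k t : R) (u : R -> 'cV[R]_n)
    (g : R -> R) :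
  sym_posdef M -> 0 <= k -> 0 < t -> vcontinuous `[0, t] u ->
  {within `[0, t], continuous g} ->
  (forall s, s \in `[0, t] -> 0 <= g s) ->
  (forall s, s \in `]0, t[ -> exists du, is_vderive u s du /\
     mass_norm M du <= g s + k * mass_norm M (u s)) ->
  mass_norm M (u t) <=
    expR (k * t) * (mass_norm M (u 0) + \int[mu]_(s in `[0, t]) g s).
Proof.
move=> Mspd k0 t0 cu cg g0 du.
apply: (gronwall_sqrt (E := fun s => mdot M (u s) (u s))) => //.
- exact: within_continuous_mdot.
- by move=> s _; exact: mdot_ge0.
move=> s /du[w [uw wle]]; exists (2 * mdot M (u s) w).
split; first exact: is_derive_mdot Mspd.1 uw.
rewrite ler_wpM2l // (le_trans (mdot_le_mass_norm Mspd _ _)) //.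
by rewrite -!mass_normE ler_wpM2l ?mass_norm_ge0.
Qed.

End Gronwall.

(** * Triple-norm estimates and the components of the error *)

Section ReducedModel.
Variable R : realType.

Lemma mass_norm0 n (M : 'M[R]_n) : mass_norm M 0 = 0.
Proof. by rewrite /mass_norm mulmx0 mxE sqrtr0. Qed.

(** [sup] bounds a set from above only if the set is bounded; the extreme value theorem supplies the
    bound. *)
Lemma max_upto_ge (t : R) (f : R -> R) s : 0 <= t ->
  {within `[0, t], continuous f} -> s \in `[0, t] -> f s <= max_upto t f.
Proof.
move=> t0 cf sI; have [c cI cP] := EVT_max t0 cf.
apply: ub_le_sup; last by exists s.
by exists (f c) => _ [r rI <-]; apply: cP.
Qed.

Lemma triple_normB_le NV NE (MV : 'M[R]_NV) (ME : 'M[R]_NE) v e x v' e' x' :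
  sym_posdef MV -> sym_posdef ME ->
  triple_norm MV ME (v - v') (e - e') (x - x') <=
  triple_norm MV ME v e x + triple_norm MV ME v' e' x'.
Proof.
move=> MVs MEs; rewrite !triple_normE //.
rewrite -(mass_normN _ (col_mx (col_mx v' e') x')) !opp_col_mx.
by rewrite -!add_col_mx; apply: mass_normD; exact: state_mass_spd.
Qed.

Lemma triple_norm_le NV NE (MV : 'M[R]_NV) (ME : 'M[R]_NE) v e x :
  sym_posdef MV -> sym_posdef ME ->
  triple_norm MV ME v e x <= mass_norm MV v + mass_norm ME e + norm2 x.
Proof.
move=> MVs MEs; rewrite triple_normE // norm2E.
apply: le_trans (mass_norm_block_le _ _ _ (sym_posdef1 R NV)) _.
  exact: sym_posdef_block.
by rewrite lerD2r mass_norm_block_le.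
Qed.

Lemma mass_norm_le_triple NV NE (MV : 'M[R]_NV) (ME : 'M[R]_NE) v e x :
  mass_norm MV v <= triple_norm MV ME v e x.
Proof.
rewrite -[leLHS]ger0_norm ?mass_norm_ge0 // -sqrtr_sqr ler_wsqrtr //.
by rewrite -addrA lerDl addr_ge0 ?sqr_ge0.
Qed.

Lemma within_continuous_triple_norm NV NE (MV : 'M[R]_NV) (ME : 'M[R]_NE)
    A v e x :
  sym_posdef MV -> sym_posdef ME ->
  vcontinuous A v -> vcontinuous A e -> vcontinuous A x ->
  {within A, continuous (fun s => triple_norm MV ME (v s) (e s) (x s))}.
Proof.
move=> MVs MEs cv ce cx.
rewrite (_ : (fun s => _) = fun s =>
  mass_norm (state_mass MV ME) (col_mx (col_mx (v s) (e s)) (x s))).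
  by apply: within_continuous_mass_norm; do 2?apply: vcontinuous_col.
by apply/funext => s; rewrite triple_normE.
Qed.

(** Supplies continuity of the forces along a trajectory, which makes the hyper-reduction integrand
    continuous and hence integrable. *)
Lemma lipschitz_vcontinuous NV NE m (MV : 'M[R]_NV) (ME : 'M[R]_NE)
    (G : state_fun R NV NE 'cV[R]_m) (K : R) A v e x :
  sym_posdef MV -> sym_posdef ME ->
  (forall v e x v' e' x', norm2 (G v e x - G v' e' x') <=
     K * triple_norm MV ME (v - v') (e - e') (x - x')) ->
  vcontinuous A v -> vcontinuous A e -> vcontinuous A x ->
  vcontinuous A (fun s => G (v s) (e s) (x s)).
Proof.
move=> MVs MEs GK cv ce cx i; apply/subspace_continuousP => t At.
(* Majorant of the increment of every coordinate, continuous in [s] and zero at [s = t]. *)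
pose h s := K * triple_norm MV ME (v t - v s) (e t - e s) (x t - x s).
have ch : {within A, continuous h}.
  apply: within_continuousM; first exact: within_continuous_cst.
  apply: within_continuous_triple_norm => //; apply: vcontinuousB => //;
    exact: vcontinuous_cst.
have ht : h t = 0.
  by rewrite /h !subrr triple_normE // !col_mx0 mass_norm0 mulr0.
apply/cvgrPdist_lt => d d0.
have /cvgrPdist_lt/(_ d d0) := (subspace_continuousP _ h).1 ch t At.
apply: filterS => s; rewrite ht sub0r normrN; apply: le_lt_trans.
apply: le_trans (ler_norm _); apply: le_trans (GK _ _ _ _ _ _).
by apply: le_trans (coord_le_norm2 _ i); rewrite !mxE.
Qed.

(** Orthonormality makes [Phi^T Phi] the identity, so the position is treated as the instance
    [M = 1] of the mass-weighted components. *)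
Lemma eucl_zetaE N n (Phi : 'M[R]_(N, n)) : orthonormal_cols Phi ->
  eucl_zeta Phi = mass_zeta 1%:M Phi.
Proof.
move=> on; apply/funext => os; apply/funext => uh; apply/funext => u.
by rewrite /mass_zeta /reduced_mass !mulmx1 on invmx1 mul1mx.
Qed.

Lemma eucl_thetaE N n (Phi : 'M[R]_(N, n)) : orthonormal_cols Phi ->
  eucl_theta Phi = mass_theta 1%:M Phi.
Proof.
move=> on; apply/funext => os; apply/funext => u.
by rewrite /mass_theta /reduced_mass !mulmx1 on invmx1 mulmx1.
Qed.

(** * A single state component: error splitting and rate of change *)

Section Component.
Variables (N n : nat) (M : 'M[R]_N) (Phi : 'M[R]_(N, n)) (os : 'cV[R]_N).

(** The projection of [u - os] is added and subtracted. Evaluated at the current time, [mass_zeta]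
    is the [rho] of the splitting; at time 0 it is the initial error. *)
Lemma error_split uh u :
  u - affine_lift os Phi uh = mass_theta M Phi os u - mass_zeta M Phi os uh u.
Proof.
rewrite /mass_theta /mass_zeta /affine_lift mulmxBl mul1mx.
rewrite (mulmxBr Phi) !mulmxA.
by rewrite opprB [RHS]addrA addrNK opprD addrA.
Qed.

Lemma vcontinuous_theta A u :
  vcontinuous A u -> vcontinuous A (fun s => mass_theta M Phi os (u s)).
Proof.
move=> cu; apply: vcontinuous_mulmx; apply: vcontinuousB => //.
exact: vcontinuous_cst.
Qed.

Lemma vcontinuous_zeta A uh u : vcontinuous A uh -> vcontinuous A u ->
  vcontinuous A (fun s => mass_zeta M Phi os (uh s) (u s)).
Proof.
move=> cuh cu; apply: vcontinuous_mulmx; apply: vcontinuousB => //.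
by apply: vcontinuous_mulmx; apply: vcontinuousB => //; exact: vcontinuous_cst.
Qed.

(** [mass_zeta] is affine in the pair [(uh, u)]; setting the offset to 0 leaves its linear part. *)
Lemma is_vderive_zeta uh u s duh du :
  is_vderive uh s duh -> is_vderive u s du ->
  is_vderive (fun s => mass_zeta M Phi os (uh s) (u s)) s
    (mass_zeta M Phi 0 duh du).
Proof.
move=> huh hu; apply: is_vderive_mulmx; apply: is_vderiveB => //.
by apply: is_vderive_mulmx; apply: is_vderiveB => //; exact: is_vderive_cst.
Qed.

(** Here [f] is the force at the full state and [ft] the one at the lifted state. The constant is
    chosen before them, from bounds on [Q] and [Q P], so the final constant is independent of the
    trajectories. *)
Lemma zeta_rate_le (P : 'M[R]_N) : sym_posdef M -> orthonormal_cols Phi ->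
  exists c, 0 <= c /\ forall f ft du duh,
    M *m du = f -> reduced_mass M Phi *m duh = Phi^T *m P *m ft ->
    mass_norm M (mass_zeta M Phi 0 duh du) <=
      c * (norm2 ((1%:M - P) *m f) + norm2 (f - ft)).
Proof.
move=> Mspd on; pose Q := Phi *m invmx (reduced_mass M Phi) *m Phi^T.
have [c1 [c10 c1P]] := mass_norm_mulmx_le M Q.
have [c2 [c20 c2P]] := mass_norm_mulmx_le M (Q *m P).
exists (c1 + c2); split=> [|f ft du duh Mdu Mduh]; first exact: addr_ge0.
have Mu : reduced_mass M Phi \in unitmx.
  by apply: sym_posdef_unit; exact: reduced_mass_spd.
have -> : mass_zeta M Phi 0 duh du =
    - (Q *m ((1%:M - P) *m f) + Q *m P *m (f - ft)).
  rewrite /mass_zeta subr0 -[in LHS](mulKmx Mu duh) Mduh.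
  rewrite -[_ *m M *m du]mulmxA Mdu mulmxBr !mulmxA -/Q.
  by rewrite mulmxBr mulmx1 mulmxBl mulmxBr addrA addrNK opprB.
rewrite mass_normN; apply: le_trans (mass_normD Mspd _ _) _.
have g1 := norm2_ge0 ((1%:M - P) *m f); have g2 := norm2_ge0 (f - ft).
apply: le_trans (lerD (c1P _) (c2P _)) _.
have := mulr_ge0 c10 g2; have := mulr_ge0 c20 g1; lra.
Qed.

End Component.
End ReducedModel.

(** * The error estimate *)

Theorem theorem5p1 (R : realType) (NV NE nv ne nx r1 m1 rtv mtv : nat)
  (MV : 'M[R]_NV) (ME : 'M[R]_NE)
  (F : state_fun R NV NE 'M[R]_(NV, NE))
  (Phiv : 'M[R]_(NV, nv)) (Phie : 'M[R]_(NE, ne)) (Phix : 'M[R]_(NV, nx))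
  (PhiF1 : 'M[R]_(NV, r1)) (ZF1 : 'M[R]_(NV, m1))
  (PhiFtv : 'M[R]_(NE, rtv)) (ZFtv : 'M[R]_(NE, mtv))
  (MV_spd : sym_posdef MV) (ME_spd : sym_posdef ME)
  (Phiv_on : orthonormal_cols Phiv) (Phie_on : orthonormal_cols Phie)
  (Phix_on : orthonormal_cols Phix)
  (ZF1_sampling : sampling_matrix ZF1) (ZFtv_sampling : sampling_matrix ZFtv)
  (le_r1_m1 : (r1 <= m1)%N) (le_rtv_mtv : (rtv <= mtv)%N)
  (ZF1_rank : \rank (ZF1^T *m PhiF1) = r1)
  (ZFtv_rank : \rank (ZFtv^T *m PhiFtv) = rtv)
  (F_lipschitz : exists K1 K2 : R, [/\ 0 < K1, 0 < K2 &
     forall (v : 'cV[R]_NV) (e : 'cV[R]_NE) (x : 'cV[R]_NV)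
            (v' : 'cV[R]_NV) (e' : 'cV[R]_NE) (x' : 'cV[R]_NV),
       norm2 (F1 F v e x - F1 F v' e' x') <=
         K1 * triple_norm MV ME (v - v') (e - e') (x - x') /\
       norm2 (Ftv F v e x - Ftv F v' e' x') <=
         K2 * triple_norm MV ME (v - v') (e - e') (x - x')]) :
  let PF1 := oblique_proj PhiF1 ZF1 in
  let PFtv := oblique_proj PhiFtv ZFtv in
  exists C : R, 0 < C /\
  forall (vos : 'cV[R]_NV) (eos : 'cV[R]_NE) (xos : 'cV[R]_NV) (tf : R)
         (v : R -> 'cV[R]_NV) (e : R -> 'cV[R]_NE) (x : R -> 'cV[R]_NV)
         (vh : R -> 'cV[R]_nv) (eh : R -> 'cV[R]_ne) (xh : R -> 'cV[R]_nx),
    FOM_solution MV ME F tf v e x ->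
    ROM_solution MV ME F Phiv Phie Phix PF1 PFtv vos eos xos tf vh eh xh ->
    forall t : R, 0 < t -> t <= tf ->
      triple_norm MV ME
        (v t - affine_lift vos Phiv (vh t))
        (e t - affine_lift eos Phie (eh t))
        (x t - affine_lift xos Phix (xh t))
      <= C * expR (C * t) *
         (triple_norm MV ME
            (mass_zeta MV Phiv vos (vh 0) (v 0))
            (mass_zeta ME Phie eos (eh 0) (e 0))
            (eucl_zeta Phix xos (xh 0) (x 0))
          + max_upto t (fun s => triple_norm MV ME
              (mass_theta MV Phiv vos (v s))
              (mass_theta ME Phie eos (e s))
              (eucl_theta Phix xos (x s)))
          + \int[lebesgue_measure]_(s in `[0, t])
              (norm2 ((1%:M - PF1) *m F1 F (v s) (e s) (x s)) +
               norm2 ((1%:M - PFtv) *m Ftv F (v s) (e s) (x s)))).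
Proof.
move=> PF1 PFtv; have [K1 [K2 [K10 K20 FL]]] := F_lipschitz.
have [c1 [c10 c1P]] := zeta_rate_le PF1 MV_spd Phiv_on.
have [c2 [c20 c2P]] := zeta_rate_le PFtv ME_spd Phie_on.
(* The position equation fits the same lemma with [M = 1], [P = 1] and the velocities in the role of
   forces. *)
have [c3 [c30 c3P]] := zeta_rate_le 1%:M (sym_posdef1 R NV) Phix_on.
have [c4 [c40 c4P]] := norm2_le_mass_norm MV_spd.
(* [c] weighs the hyper-reduction terms and [k] the total error; [c4] turns the Euclidean velocity
   error of the position equation into a mass norm. *)
pose c := c1 + c2; pose k := c1 * K1 + c2 * K2 + c3 * c4.
have c0 : 0 <= c by exact: addr_ge0.
have k0 : 0 <= k by rewrite !addr_ge0 // mulr_ge0 // ltW.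
(* [2 * k] accommodates the square of the Gronwall factor [exp (k t)], [c] the weight of the
   integral, and 1 ensures [1 <= C]. *)
exists (1 + c + 2 * k); split.
  by rewrite -addrA ltr_pwDl // addr_ge0 ?mulr_ge0.
move=> vos eos xos tf v e x vh eh xh fom rom t t0 ttf.
set C := 1 + c + 2 * k.
have sub_cc : `[0, t] `<=` `[0, tf].
  by move=> s /=; rewrite !in_itv /= => /andP[-> /le_trans->].
have sub_oo s : s \in `]0, t[ -> s \in `]0, tf[.
  by rewrite !in_itv /= => /andP[-> /lt_le_trans->].
have cont n (f : R -> 'cV[R]_n) :
    (forall s, s \in `[0, tf] -> exists l, has_deriv_within `[0, tf] f s l) ->
    vcontinuous `[0, t] f.
  by move=> df; apply: vcontinuousW sub_cc _; exact: deriv_within_vcontinuous.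
have cv : vcontinuous `[0, t] v.
  by apply: cont => s /fom[dv [_ [_ [[hv _ _] _]]]]; exists dv.
have ce : vcontinuous `[0, t] e.
  by apply: cont => s /fom[_ [de [_ [[_ he _] _]]]]; exists de.
have cx : vcontinuous `[0, t] x.
  by apply: cont => s /fom[_ [_ [dx [[_ _ hx] _]]]]; exists dx.
have cvh : vcontinuous `[0, t] vh.
  by apply: cont => s /rom[dv [_ [_ [[hv _ _] _]]]]; exists dv.
have ceh : vcontinuous `[0, t] eh.
  by apply: cont => s /rom[_ [de [_ [[_ he _] _]]]]; exists de.
have cxh : vcontinuous `[0, t] xh.
  by apply: cont => s /rom[_ [_ [dx [[_ _ hx] _]]]]; exists dx.
rewrite eucl_zetaE // eucl_thetaE //.
pose theta s := triple_norm MV ME (mass_theta MV Phiv vos (v s))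
  (mass_theta ME Phie eos (e s)) (mass_theta 1%:M Phix xos (x s)).
(* Unlike [theta] and [eps], which are norms, [rho] stays a stacked vector because it has to be
   differentiated. *)
pose rho s := col_mx (col_mx (mass_zeta MV Phiv vos (vh s) (v s))
  (mass_zeta ME Phie eos (eh s) (e s))) (mass_zeta 1%:M Phix xos (xh s) (x s)).
pose eps s := triple_norm MV ME (v s - affine_lift vos Phiv (vh s))
  (e s - affine_lift eos Phie (eh s)) (x s - affine_lift xos Phix (xh s)).
pose g s := norm2 ((1%:M - PF1) *m F1 F (v s) (e s) (x s)) +
  norm2 ((1%:M - PFtv) *m Ftv F (v s) (e s) (x s)).
rewrite -/theta -/g -/(eps t) triple_normE // -/(rho 0).
set S := state_mass MV ME; set Theta := max_upto t _.
have S_spd : sym_posdef S by exact: state_mass_spd.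
have theta_le s : s \in `[0, t] -> theta s <= Theta.
  apply: (@max_upto_ge _ t theta _ (ltW t0)).
  by apply: within_continuous_triple_norm => //; exact: vcontinuous_theta.
have Theta0 : 0 <= Theta.
  by apply: le_trans (theta_le 0 _); rewrite ?sqrtr_ge0 // in_itv /= lexx ltW.
have eps_le s : s \in `[0, t] -> eps s <= Theta + mass_norm S (rho s).
  move=> /theta_le th; rewrite /eps (error_split MV) (error_split ME).
  rewrite (error_split 1%:M).
  apply: le_trans (triple_normB_le _ _ _ _ _ _ _ _) _ => //.
  by rewrite [X in _ + X <= _]triple_normE // lerD2r.
have cg : {within `[0, t], continuous g}.
  apply: within_continuousD.
    rewrite (_ : (fun s => _) = fun s =>
      mass_norm 1%:M ((1%:M - PF1) *m F1 F (v s) (e s) (x s))).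
      apply: within_continuous_mass_norm; apply: vcontinuous_mulmx.
      apply: (lipschitz_vcontinuous (MV := MV) (ME := ME) (K := K1)) => //.
      by move=> v1 e1 x1 v2 e2 x2; have [] := FL v1 e1 x1 v2 e2 x2.
    by apply/funext => s; rewrite norm2E.
  rewrite (_ : (fun s => _) = fun s =>
    mass_norm 1%:M ((1%:M - PFtv) *m Ftv F (v s) (e s) (x s))).
    apply: within_continuous_mass_norm; apply: vcontinuous_mulmx.
    apply: (lipschitz_vcontinuous (MV := MV) (ME := ME) (K := K2)) => //.
    by move=> v1 e1 x1 v2 e2 x2; have [] := FL v1 e1 x1 v2 e2 x2.
  by apply/funext => s; rewrite norm2E.
have g0 s : 0 <= g s by rewrite addr_ge0 ?norm2_ge0.
have rho_rate s : s \in `]0, t[ -> exists drho, is_vderive rho s drho /\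
    mass_norm S drho <= c * g s + k * eps s.
  move=> sI; have sI' : s \in `[0, tf].
    by apply: subset_itv_oo_cc; exact: sub_oo.
  have [dv [de [dx [[hv he hx] [Edv Ede Edx]]]]] := fom s sI'.
  have [dvh [deh [dxh [[hvh heh hxh] [Edvh Edeh Edxh]]]]] := rom s sI'.
  have D n (f : R -> 'cV[R]_n) l :=
    @deriv_within_is_vderive R n 0 tf f s l (sub_oo s sI).
  exists (col_mx (col_mx (mass_zeta MV Phiv 0 dvh dv)
    (mass_zeta ME Phie 0 deh de)) (mass_zeta 1%:M Phix 0 dxh dx)).
  split.
    by do 2?apply: is_vderive_col; apply: is_vderive_zeta; exact: D.
  rewrite -triple_normE //.
  apply: le_trans (triple_norm_le _ _ _ MV_spd ME_spd) _.
  rewrite norm2E.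
  (* Both velocity equations carry a minus sign, so [c1P] is applied to the negated forces. *)
  move: Edvh; rewrite -mulmxN => /(c1P _ _ _ _ Edv).
  move: Edeh => /(c2P _ _ _ _ Ede).
  have : reduced_mass 1%:M Phix *m dxh =
      Phix^T *m 1%:M *m affine_lift vos Phiv (vh s).
    by rewrite /reduced_mass !mulmx1 Phix_on mul1mx.
  have /(c3P (v s)) : 1%:M *m dx = v s by rewrite mul1mx.
  move=> /[apply].
  (* With [P = 1] the position has no projection term, and the minus signs of the velocity equations
     disappear under the norm. *)
  rewrite subrr mul0mx norm2E mass_norm0 add0r mulmxN norm2N -opprD norm2N.
  set vt := affine_lift vos _ _; set et := affine_lift eos _ _.
  set xt := affine_lift xos _ _.
  have [L1 L2] := FL (v s) (e s) (x s) vt et xt.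
  have L3 : norm2 (v s - vt) <= c4 * eps s.
    apply: le_trans (c4P _) _; rewrite ler_wpM2l //.
    exact: mass_norm_le_triple.
  move: L1 L2; rewrite -/(eps s) => L1 L2.
  have := ler_wpM2l c10 L1; have := ler_wpM2l c20 L2; have := ler_wpM2l c30 L3.
  have := mulr_ge0 c10 (norm2_ge0 ((1%:M - PFtv) *m Ftv F (v s) (e s) (x s))).
  have := mulr_ge0 c20 (norm2_ge0 ((1%:M - PF1) *m F1 F (v s) (e s) (x s))).
  rewrite /c /k /g; lra.
have kTheta0 : 0 <= k * Theta by exact: mulr_ge0.
have cgk : {within `[0, t], continuous (fun s => c * g s + k * Theta)}.
  apply: within_continuousD (@within_continuous_cst _ _ _).
  by apply: within_continuousM cg; exact: within_continuous_cst.
have crho : vcontinuous `[0, t] rho.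
  by do 2?apply: vcontinuous_col; exact: vcontinuous_zeta.
(* Since [eps <= Theta + |rho|], the rate of [rho] is at most [(c g + k Theta) + k |rho|], which is
   the Gronwall form with forcing [c g + k Theta]. *)
have rho_le : mass_norm S (rho t) <= expR (k * t) *
    (mass_norm S (rho 0) +
     \int[lebesgue_measure]_(s in `[0, t]) (c * g s + k * Theta)).
  apply: gronwall_mass_norm => // [s _|s sI].
    by rewrite addr_ge0 ?mulr_ge0.
  have [drho [hrho drho_le]] := rho_rate s sI; exists drho; split=> //.
  apply: le_trans drho_le _; rewrite -addrA lerD2l -mulrDr ler_wpM2l //.
  by apply: eps_le; exact: subset_itv_oo_cc.
have int_g := continuous_itv_integrable cg.
have int_gk : \int[lebesgue_measure]_(s in `[0, t]) (c * g s + k * Theta) =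
    c * \int[lebesgue_measure]_(s in `[0, t]) g s + k * Theta * t.
  rewrite RintegralD //=; last 2 first.
  - apply: continuous_itv_integrable; apply: within_continuousM cg.
    exact: within_continuous_cst.
  - by apply: continuous_itv_integrable; exact: within_continuous_cst.
  rewrite RintegralZl // Rintegral_cst //= lebesgue_measure_itv /= lte_fin t0.
  by rewrite -EFinD /= subr0.
have tI : t \in `[0, t] by rewrite in_itv /= lexx ltW.
apply: le_trans (eps_le t tI) _; move: rho_le; rewrite int_gk.
set I := \int[_]_(_ in _) g _; set r0 := mass_norm S (rho 0).
set q := expR (k * t) => rho_le.
have I0 : 0 <= I by apply: Rintegral_ge0.
have r00 : 0 <= r0 by exact: mass_norm_ge0.
apply: le_trans (lerD (lexx _) rho_le) _.
have kt0 : 0 <= k * t by rewrite mulr_ge0 // ltW.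
have q1 : 1 + k * t <= q by exact: expR_ge1Dx.
have q2 : q ^+ 2 <= expR (C * t).
  rewrite -expRM_natl ler_expR mulrA ler_wpM2r //; first exact: ltW.
  by rewrite /C lerDr addr_ge0.
have C1 : 1 <= C by rewrite /C -addrA lerDl addr_ge0 ?mulr_ge0.
have Cc : c <= C by rewrite /C; lra.
have q_ge1 : 1 <= q by lra.
have q_ge0 : 0 <= q by lra.
have q3 : q <= q ^+ 2 by rewrite expr2 ler_peMl.
(* The factor [t] from integrating the constant [k * Theta] costs a second exponential:
   [1 + q k t <= q (1 + k t) <= q^2]. *)
have T1 : Theta + q * (k * Theta * t) <= q ^+ 2 * Theta.
  have -> : Theta + q * (k * Theta * t) = (1 + q * (k * t)) * Theta by ring.
  rewrite ler_wpM2r // expr2; apply: le_trans (ler_wpM2l q_ge0 q1).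
  by rewrite mulrDr mulr1 lerD2r.
have CQ : q ^+ 2 <= C * expR (C * t).
  by apply: (le_trans q2); rewrite ler_peMl ?expR_ge0.
(* Here [C] absorbs [c] and [exp (C t)] absorbs [q]; for the other terms [1 <= C] and
   [q^2 <= exp (C t)] suffice. *)
have T2 : q * (c * I) <= C * expR (C * t) * I.
  rewrite mulrA ler_wpM2r // [q * c]mulrC; apply: ler_pM => //.
  exact: le_trans q3 q2.
have T3 : q * r0 <= C * expR (C * t) * r0.
  by rewrite ler_wpM2r //; exact: le_trans q3 CQ.
have T4 := ler_wpM2r Theta0 CQ.
rewrite !mulrDr; lra.
Qed.
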